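(* Let $m>n\ge 1$ be integers. Let $Q:\mathbb{R}\to M_{m}(\mathbb{R})$ be continuous, and let $\Phi:\mathbb{R}\to M_{n m}(\mathbb{R})$ and $\Phi^{+}:\mathbb{R}\to M_{m n}(\mathbb{R})$ be continuously differentiable, with $\operatorname{rank}\Phi(t)=n$ for all $t\in\mathbb{R}$ and $\Phi^{+}(t)$ a pseudoinverse of $\Phi(t)$ in the sense that $\Phi(t)\Phi^{+}(t)=E_n$ for all $t\in\mathbb{R}$. Put $$M(t)=\Phi^{+}(t)\Phi(t)\in M_m(\mathbb{R}),$$ $$M^{n}(t)=\{y\in\mathbb{R}^{m}: y=M(t)y\},\qquad M^{m-n}(t)=\{y\in\mathbb{R}^{m}: M(t)y=0\},$$ $$L(M(t),Q(t))=\frac{dM(t)}{dt}+M(t)Q(t)-Q(t)M(t).$$ Consider the differential equation $$\frac{dy}{dt}=Q(t)y,\qquad y\in\mathbb{R}^m. \tag{I}$$ Then the following assertions hold. 1. The subspaces $M^{n}(t)$ and $M^{m-n}(t)$ are both invariant manifolds of (I) if and only if $L(M(t),Q(t))=0$ for all $t\in\mathbb{R}$. 2. The subspace $M^{n}(t)$ is an invariant manifold of (I) if and only if $L(M(t),Q(t))M(t)=0$ for all $t\in\mathbb{R}$. Moreover, if $M^{n}(t)$ is an invariant manifold of (I), then on $M^{n}(t)$, parametrized by the diffeomorphism $y=\Phi^{+}(t)x$, $x\in\mathbb{R}^{n}$, equation (I) is equivalent to the equation $$\frac{dx}{dt}=P(t)x,\qquad P(t)=\left(\frac{d\Phi(t)}{dt}+\Phi(t)Q(t)\right)\Phi^{+}(t),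 \tag{II}$$ that is, the fundamental matrices of solutions $Y(t)$ of (I) with $Y(0)=E_m$ and $X(t)$ of (II) with $X(0)=E_n$ satisfy, for all $t\in\mathbb{R}$, $$Y(t)\Phi^{+}(0)=\Phi^{+}(t)X(t),\qquad X(t)=\Phi(t)Y(t)\Phi^{+}(0).$$ 3. If $M^{m-n}(t)$ is an invariant manifold of (I), then $\ker L(M(t),Q(t))\supset M^{m-n}(t)$ for all $t\in\mathbb{R}$.
   Context: $M_{kl}(\mathbb{R})$ denotes the set of real $k\times l$ matrices, $M_k(\mathbb{R})=M_{kk}(\mathbb{R})$, and $E_k$ is the $k\times k$ identity matrix. A family of subspaces $S(t)\subset\mathbb{R}^m$, $t\in\mathbb{R}$, is called an invariant manifold (equivalently, an integral manifold) of the equation $\frac{dy}{dt}=Q(t)y$ if, for every solution $y=y(t)$ of this equation, the inclusion $y(t_0)\in S(t_0)$ for some $t_0\in\mathbb{R}$ implies $y(t)\in S(t)$ for all $t\in\mathbb{R}$ (that is, the set $\{(t,y): t\in\mathbb{R},\ y\in S(t)\}$ is a union of integral curves of the equation). *)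

(* Defs.v *)
From HB Require Import structures.
From mathcomp Require Import all_boot all_order all_algebra.
From mathcomp Require Import all_classical all_reals all_analysis.
Import Order.TTheory GRing.Theory Num.Theory.
Import numFieldNormedType.Exports.

Set Implicit Arguments.
Unset Strict Implicit.
Unset Printing Implicit Defensive.

Local Open Scope classical_set_scope.
Local Open Scope ring_scope.

Definition continuously_differentiable (R : realType) (V : normedModType R)
    (f : R -> V) : Prop :=
  (forall t : R, derivable f t 1) /\ continuous (derive1 f).

(* Order-k directional derivatives; in finite dimension this is the usual
   C^k class. *)
Fixpoint Ck (R : realType) (V W : normedModType R) (k : nat) (f : V -> W) :
    Prop :=
  if k is k'.+1 then
    (forall x : V, differentiable f x) /\
    (forall v : V, Ck k' (fun x : V => 'D_v f x))
  else continuous f.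

Definition smooth (R : realType) (V W : normedModType R) (f : V -> W) : Prop :=
  forall k : nat, Ck k f.

(* Diffeomorphism of V onto a subset S of W.  A map on S is smooth when it is
   the restriction of a smooth map on the ambient space; a global extension g
   is the right notion for the closed sets S considered here (linear
   subspaces of a finite-dimensional W). *)
Definition diffeomorphism_onto (R : realType) (V W : normedModType R)
    (S : set W) (f : V -> W) : Prop :=
  [/\ smooth f, set_bij [set: V] S f &
      exists g : W -> V, smooth g /\ (forall x : V, g (f x) = x)].

(* With k = 1: a solution, defined on the whole line, of dy/dt = A(t) y; with
   k = m: a matrix solution. *)
Definition linear_ode_solution (R : realType) (m k : nat)
    (A : R -> 'M[R]_m) (Y : R -> 'M[R]_(m, k)) : Prop :=
  forall t : R, is_derive t (1 : R) Y (A t *m Y t).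

Definition fundamental_matrix (R : realType) (m : nat)
    (A Y : R -> 'M[R]_m) : Prop :=
  linear_ode_solution A Y /\ Y 0 = 1%:M.

Definition invariant_manifold (R : realType) (m : nat)
    (Q : R -> 'M[R]_m) (S : R -> set 'cV[R]_m) : Prop :=
  forall y : R -> 'cV[R]_m, linear_ode_solution Q y ->
  forall t0 : R, S t0 (y t0) -> forall t : R, S t (y t).

Definition fix_space (R : realType) (m : nat) (M : R -> 'M[R]_m) (t : R) :
    set 'cV[R]_m := [set y | y = M t *m y].

Definition null_space (R : realType) (m : nat) (M : R -> 'M[R]_m) (t : R) :
    set 'cV[R]_m := [set y | M t *m y = 0].

Definition Lop (R : realType) (m : nat) (M Q : R -> 'M[R]_m) (t : R) :
    'M[R]_m := derive1 M t + M t *m Q t - Q t *m M t.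

(* Main.v *)
From HB Require Import structures.
Require Import Defs.
From mathcomp Require Import all_boot all_order all_algebra.
From mathcomp Require Import all_classical all_reals all_analysis.
From mathcomp Require Import ring lra.
Import Order.TTheory GRing.Theory Num.Theory.
Import numFieldNormedType.Exports.

(** Write [L = M' + M Q - Q M], where [M = Phip Phi] is a continuously
    differentiable field of projections, since [Phi Phip = 1].

    Suppose that the fixed spaces of [M] are invariant.  Through each of their
    points there passes a solution [y], which satisfies [y = M y] at all times;
    differentiating gives [Q y = M' y + M Q y], that is [L y = 0].  The fixed
    space of [M] is its image, so this means [L M = 0].  In the same way,
    invariance of the null spaces gives [L y = 0] whenever [M y = 0]; as a
    projection splits the space into its image and its kernel, both invariances
    together give [L = 0].

    Conversely, let [y' = Q y].  The component [w = y - M y] satisfies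
    [w' = Q w - L y].  If [L M = 0], then [L y = L w] and [w] solves the linear
    equation [w' = (Q - L) w]; if [L = 0], then [M y] solves [z' = Q z].  By
    uniqueness these components vanish at all times once they vanish at one
    time, which is the invariance of the fixed spaces, respectively of the null
    spaces. Uniqueness also identifies [X] with [Phi Y Phip(0)] when the fixed
    spaces are invariant.

    Existence is essential: invariance quantifies over solutions defined on the
    whole line and would be vacuous if there were none.  So the analytic core is
    the global Cauchy theory of [y' = A y] with [A] continuous on the line:
    [linear_ode_exists] and [linear_ode_zero].  Both rest on
    [picard_contraction], which says that the Picard operator halves distances
    for the weight [exp (2 K |t - t0|)] on any compact interval centred at [t0];
    the operator itself comes from [exists_primitive], a consequence of the
    fundamental theorem of calculus for the Lebesgue integral. *)

Set Implicit Arguments.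
Unset Strict Implicit.
Unset Printing Implicit Defensive.

Local Open Scope classical_set_scope.
Local Open Scope ring_scope.

(** * Calculus of matrix-valued functions of a real variable *)

Lemma is_derive_continuous (R : realType) (V : normedModType R)
    (f df : R -> V) :
  (forall t, is_derive t (1 : R) f (df t)) -> continuous f.
Proof.
move=> dfE t; apply: differentiable_continuous; apply/derivable1_diffP.
by case: (dfE t).
Qed.

Lemma is_derive_derive1 (R : realType) (V : normedModType R)
    (f : R -> V) (t : R) :
  derivable f t 1 -> is_derive t (1 : R) f (derive1 f t).
Proof. by move=> df; rewrite derive1E; exact: derivableP. Qed.

Lemma is_derive_unique (R : realType) (V : normedModType R) (f : R -> V)
    (t : R) (a b : V) :
  is_derive t (1 : R) f a -> is_derive t (1 : R) f b -> a = b.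
Proof. by move=> fa fb; rewrite -(derive_val (is_derive := fa)) derive_val. Qed.

Lemma is_derive_mxP (R : realType) (m n : nat) (M : R -> 'M[R]_(m, n)) (t : R)
    (D : 'M[R]_(m, n)) :
  is_derive t 1 M D <->
  forall i j, is_derive t 1 (fun s => M s i j) (D i j).
Proof.
split=> [[dM <-] i j|dM].
  rewrite derive_mx// mxE; apply: derivableP.
  by have /derivable_mxP := dM; apply.
have cM : derivable M t 1 by apply/derivable_mxP => i j; case: (dM i j).
split => //; rewrite derive_mx//; apply/matrixP => i j.
by rewrite mxE; case: (dM i j).
Qed.

Lemma is_derive_mulmx (R : realType) (m n p : nat) (A : R -> 'M[R]_(m, n))
    (B : R -> 'M[R]_(n, p)) (t : R) dA dB :
  is_derive t 1 A dA -> is_derive t 1 B dB ->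
  is_derive t 1 (fun s => A s *m B s) (dA *m B t + A t *m dB).
Proof.
move=> /is_derive_mxP hA /is_derive_mxP hB; apply/is_derive_mxP => i j.
have -> : (fun s => (A s *m B s) i j) =
          \sum_k ((fun s => A s i k) * (fun s => B s k j)).
  by apply/funext => s; rewrite mxE fct_sumE.
have -> : (dA *m B t + A t *m dB) i j =
          \sum_k (A t i k *: dB k j + B t k j *: dA i k).
  rewrite !mxE -big_split; apply: eq_bigr => k _ /=.
  by rewrite addrC [dA _ _ * _]mulrC.
by apply: is_derive_sum => k; exact: is_deriveM.
Qed.

Lemma continuous_mx (R : realType) (T : topologicalType) (m n : nat)
    (M : T -> 'M[R]_(m, n)) (t : T) :
  (forall i j, {for t, continuous (fun s => M s i j)}) -> {for t, continuous M}.
Proof.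
move=> cM; apply/cvgrPdist_le => e e0; near=> s.
rewrite /Num.Def.normr/= mx_normrE (bigmax_le _ (ltW e0))//= => ij _.
rewrite !mxE/=; move: ij; near: s; apply: filter_forall => -[i j].
by have /cvgrPdist_le/(_ _ e0) := cM i j.
Unshelve. all: by end_near. Qed.

Lemma ler_norm_entry (R : realType) (m n : nat) (A : 'M[R]_(m, n)) i j :
  `|A i j| <= `|A|.
Proof.
by rewrite [leRHS]/Num.Def.normr/= mx_normrE; exact: (le_bigmax _ _ (i, j)).
Qed.

Lemma ler_norm_mx (R : realType) (m n : nat) (A : 'M[R]_(m, n)) (c : R) :
  0 <= c -> (forall i j, `|A i j| <= c) -> `|A| <= c.
Proof.
move=> c0 Ac; rewrite [leLHS]/Num.Def.normr/= mx_normrE.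
by apply: bigmax_le => // -[i j] _; exact: Ac.
Qed.

Lemma continuous_mulmx (R : realType) (T : topologicalType) (m n p : nat)
    (A : T -> 'M[R]_(m, n)) (B : T -> 'M[R]_(n, p)) (t : T) :
  {for t, continuous A} -> {for t, continuous B} ->
  {for t, continuous (fun s => A s *m B s)}.
Proof.
move=> cA cB; apply: continuous_mx => i j.
rewrite (_ : (fun s => _) = (fun s => \sum_k (A s i k * B s k j))); last first.
  by apply/funext => s; rewrite mxE.
apply: cvg_big => [|k _]; first exact: add_continuous.
have cE (q r : nat) (C : T -> 'M[R]_(q, r)) a b : {for t, continuous C} ->
    {for t, continuous (fun s => C s a b)}.
  move=> cC; apply: (@continuous_comp _ _ _ C (fun N => N a b)) => //.
  exact: coord_continuous.
exact: (@continuousM _ _ (fun s => A s i k) (fun s => B s k j) _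
  (cE _ _ _ _ _ cA) (cE _ _ _ _ _ cB)).
Qed.

Lemma norm_mulmx (R : realType) (m n p : nat) (A : 'M[R]_(m, n))
    (B : 'M[R]_(n, p)) : `|A *m B| <= n%:R * `|A| * `|B|.
Proof.
apply: ler_norm_mx => [|i j]; first by rewrite !mulr_ge0.
rewrite mxE (le_trans (ler_norm_sum _ _ _))//.
rewrite -mulrA mulr_natl -[X in _ *+ X]card_ord -sumr_const ler_sum// => k _.
by rewrite normrM ler_pM// ler_norm_entry.
Qed.

(** * Primitives of continuous functions *)

(** A function vanishing to the left of [0] is integrable on every half-line
    [`]-oo, u]], so a single integral with base point [-oo] is a primitive on
    the whole line; a finite base point would only give one to its right. *)
Lemma primitive_vanishing (R : realType) (f : R -> R) :
  continuous f -> (forall x, x <= 0 -> f x = 0) ->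
  exists F : R -> R, forall x, is_derive x (1 : R) F (f x).
Proof.
move=> cf f0.
exists (fun x => \int[lebesgue_measure]_(t in `]-oo, x]) f t)%R => x.
have [] := @continuous_FTC1 R f -oo%O x (x + 1).
- by rewrite ltrDl.
- have /(integrable_mkcond _ _).1 : lebesgue_measure.-integrable `[0, (x + 1)]
      (EFin \o f).
    apply: continuous_compact_integrable; first exact: segment_compact.
    exact: continuous_subspaceT.
  move=> /(_ (measurable_itv _)) If.
  apply/integrable_mkcond => //.
  apply: eq_integrable If => // y _.
  rewrite !patchE !mem_setE !in_itv/=.
  have [y0|y0] := leP 0 y => //=.
  by rewrite f0 ?(ltW y0)//; case: ifP.
- by rewrite ltNyr.
- exact: cf.
move=> dF <-; rewrite derive1E; exact: derivableP.
Qed.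

(** The function splits as [f x = f 0 + p x + q (- x)], where
    [p x = f (max x 0) - f 0] and [q x = f (- max x 0) - f 0] vanish for
    [x <= 0]; each of the three terms has a primitive. *)
Lemma exists_primitive (R : realType) (f : R -> R) :
  continuous f -> exists F : R -> R, forall x, is_derive x (1 : R) F (f x).
Proof.
move=> cf.
have half (g : R -> R) : continuous g ->
    exists G : R -> R, forall x, is_derive x (1 : R) G (g (Num.max x 0) - g 0).
  move=> cg; apply: primitive_vanishing => [x|x x0]; last first.
    by rewrite max_r// subrr.
  apply: cvgB; last exact: cvg_cst.
  apply: (@continuous_comp _ _ _ (fun y : R => Num.max y 0) g); last exact: cg.
  apply: (@continuous_comp _ _ _ (fun y : R => (y, 0 : R))
    (fun z : R * R => Num.max z.1 z.2)); last exact: max_continuous.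
  exact: (cvg_pair cvg_id (@cvg_cst _ _ _ _ _)).
have [G dG] := half f cf.
have [|H dH] := half (f \o -%R).
  by move=> x; apply: continuous_comp; [exact: opp_continuous|exact: cf].
exists (f 0 *: id + (G - (H \o -%R))) => x.
have dHN : is_derive x (1 : R) (H \o -%R)
    (((f \o -%R) (Num.max (- x) 0) - (f \o -%R) 0) * - 1).
  by apply: is_derive1_comp; exact: dH.
have dlin : is_derive x (1 : R) (f 0 *: id) (f 0 *: (1 : R)).
  exact: is_deriveZ.
apply: (is_derive_eq (is_deriveD dlin (is_deriveB (dG x) dHN))).
rewrite /= oppr0 [_%:A]mulr1; have [x0|/ltW x0] := leP 0 x.
  by rewrite max_r ?oppr_le0// oppr0 subrr mul0r subr0 subrKC.
by rewrite max_l ?oppr_ge0// opprK subrr mulrN1 opprK add0r subrKC.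
Qed.

Lemma exists_primitive_mx (R : realType) (m n : nat) (f : R -> 'M[R]_(m, n))
    (t0 : R) : continuous f ->
  exists F : R -> 'M[R]_(m, n),
    F t0 = 0 /\ forall t, is_derive t (1 : R) F (f t).
Proof.
move=> cf.
have /choice[F dF] (ij : 'I_m * 'I_n) : exists F : R -> R,
    forall t, is_derive t (1 : R) F (f t ij.1 ij.2).
  apply: exists_primitive => t.
  apply: (@continuous_comp _ _ _ f (fun N : 'M[R]_(m, n) => N ij.1 ij.2)).
    exact: cf.
  exact: coord_continuous.
exists (fun t => \matrix_(i, j) (F (i, j) t - F (i, j) t0)); split.
  by apply/matrixP => i j; rewrite !mxE subrr.
move=> t; apply/is_derive_mxP => i j.
rewrite (_ : (fun s => _) = F (i, j) - cst (F (i, j) t0)); last first.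
  by apply/funext => s; rewrite !mxE.
rewrite -[f t i j]subr0.
exact: is_deriveB.
Qed.

(** * Existence and uniqueness for linear equations *)

(** Integrating a bound by [K a exp (2 K |s - t0|)] multiplies it by at most
    [1 / (2 K)], whence the factor [1 / 2].  This is the reason for measuring
    functions with the exponential weight (Bielecki's norm): the interval on
    which the Picard operator contracts need not be short.

    Both sides of [t0] are treated together by following the segment from [t0]
    to [t], on which [G] is the gap between bound and function. *)
Lemma growth_comparison_le (R : realType) (f df : R -> R) (t0 T K a t : R) :
  0 <= a -> (forall s, is_derive s (1 : R) f (df s)) -> f t0 = 0 ->
  (forall s, `|s - t0| <= T -> `|df s| <= K * a * expR (2 * K * `|s - t0|)) ->
  `|t - t0| <= T -> f t <= a / 2 * expR (2 * K * `|t - t0|).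
Proof.
move=> a0 dfE f0 dfle tT; set d := `|t - t0|.
pose G := (fun s : R => a / 2 * expR (2 * K * d * s)) -
  (f \o (fun s : R => s * (t - t0) + t0)).
pose dG := fun s : R => K * a * d * expR (2 * K * d * s) -
  df (s * (t - t0) + t0) * (t - t0).
have dGE s : is_derive s (1 : R) G (dG s).
  apply: is_deriveB.
    have -> : (fun s : R => a / 2 * expR (2 * K * d * s)) =
      (a / 2) *: (expR \o ((2 * K * d) *: id)) by [].
    by apply: is_derive_eq; rewrite /= /GRing.scale/=; field.
  have : is_derive s (1 : R) (fun s : R => s * (t - t0) + t0) (t - t0).
    have -> : (fun s : R => s * (t - t0) + t0) = ((t - t0) *: id) + cst t0.
      by apply/funext => u; congr (_ + _); exact: mulrC.
    by apply: is_derive_eq; rewrite addr0 [LHS]mulr1.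
  by move=> dh; exact: is_derive1_comp.
have [|s /andP[s0 s1]] := @MVT_segment R G dG 0 1 ler01 (fun s _ => dGE s).
  by apply: derivable_within_continuous => s _; case: (dGE s).
rewrite subr0 mulr1 => GE.
have : 0 <= dG s.
  rewrite /dG subr_ge0 (le_trans (ler_norm _))// normrM -/d.
  have s1d : s * d <= d by rewrite ler_piMl// /d.
  have := dfle (s * (t - t0) + t0).
  rewrite addrK normrM (ger0_norm s0) -/d => /(_ (le_trans s1d tT)) h.
  rewrite (le_trans (ler_wpM2r _ h))// ?/d//.
  rewrite le_eqVlt; apply/predU1P; left.
  by rewrite mulrAC mulrA [_ * s]mulrC !mulrA; congr (_ * expR _); ring.
rewrite -GE subr_ge0.
have -> : G 0 = a / 2.
  by rewrite /G !fctE/= mulr0 expR0 mulr1 mul0r add0r f0 subr0.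
have -> : G 1 = a / 2 * expR (2 * K * d) - f t.
  by rewrite /G !fctE/= mulr1 mul1r subrK.
by move/(le_trans (divr_ge0 a0 (ler0n R 2))); rewrite subr_ge0.
Qed.

Lemma growth_comparison (R : realType) (m k : nat) (w dw : R -> 'M[R]_(m, k))
    (t0 T K a t : R) :
  0 <= a -> (forall s, is_derive s (1 : R) w (dw s)) -> w t0 = 0 ->
  (forall s, `|s - t0| <= T -> `|dw s| <= K * a * expR (2 * K * `|s - t0|)) ->
  `|t - t0| <= T -> `|w t| <= a / 2 * expR (2 * K * `|t - t0|).
Proof.
move=> a0 dwE w0 dwle tT; apply: ler_norm_mx => [|i j].
  by rewrite mulr_ge0 ?expR_ge0// divr_ge0.
have dE s : is_derive s (1 : R) (fun u => w u i j) (dw s i j).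
  by move/is_derive_mxP : (dwE s).
have dle s : `|s - t0| <= T ->
    `|dw s i j| <= K * a * expR (2 * K * `|s - t0|).
  by move=> sT; rewrite (le_trans (ler_norm_entry _ _ _))// dwle.
rewrite ler_norml; apply/andP; split.
  rewrite lerNl; apply: (@growth_comparison_le R (fun u => - w u i j)
    (fun u => - dw u i j) _ T) => //.
  - by rewrite w0 mxE oppr0.
  - by move=> s; rewrite normrN; exact: dle.
apply: (@growth_comparison_le R (fun u => w u i j) _ _ T _ _ _ a0 dE) => //.
by rewrite w0 mxE.
Qed.

(** The continuous coefficient is bounded on the compact interval
    [`[t0 - T, t0 + T]], so that multiplication by it is Lipschitz there. *)
Lemma mulmx_bound (R : realType) (n k : nat) (A : R -> 'M[R]_n) (t0 T : R) :
  continuous A -> 0 <= T ->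
  exists2 K, 0 <= K & forall s, `|s - t0| <= T ->
    forall v : 'M[R]_(n, k), `|A s *m v| <= K * `|v|.
Proof.
move=> cA T0.
have [||c _ cmax] := @EVT_max R (fun s => `|A s|) (t0 - T) (t0 + T).
- lra.
- apply: continuous_subspaceT => s.
  apply: continuous_comp; [exact: cA|exact: norm_continuous].
exists (n%:R * `|A c|) => [|s sT v]; first by rewrite mulr_ge0.
rewrite (le_trans (norm_mulmx _ _))// ler_wpM2r// ler_wpM2l//.
by apply: cmax; rewrite in_itv/=; move: sT; rewrite ler_distl.
Qed.

(** One Picard step halves distances in the weighted norm.  With [z := v] on
    both sides this gives uniqueness; applied to successive iterates, and to an
    iterate and the limit, it gives existence. *)
Lemma picard_contraction (R : realType) (n k : nat) (A : R -> 'M[R]_n)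
    (z1 z2 v1 v2 : R -> 'M[R]_(n, k)) (t0 T K a : R) :
  0 <= K -> 0 <= a ->
  (forall s, `|s - t0| <= T ->
    forall v : 'M[R]_(n, k), `|A s *m v| <= K * `|v|) ->
  (forall s, is_derive s (1 : R) v1 (A s *m z1 s)) ->
  (forall s, is_derive s (1 : R) v2 (A s *m z2 s)) ->
  v1 t0 = v2 t0 ->
  (forall s, `|s - t0| <= T ->
    `|z1 s - z2 s| <= a * expR (2 * K * `|s - t0|)) ->
  forall s, `|s - t0| <= T ->
    `|v1 s - v2 s| <= a / 2 * expR (2 * K * `|s - t0|).
Proof.
move=> K0 a0 AK dv1 dv2 v12 z12 s sT.
apply: (@growth_comparison R n k (v1 - v2)
  (fun s => A s *m (z1 s - z2 s)) t0 T) => //.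
- by move=> u; rewrite mulmxBr; exact: is_deriveB.
- by apply/eqP; rewrite subr_eq0 v12.
- move=> u uT; rewrite (le_trans (AK _ uT _))// -mulrA ler_wpM2l//.
  exact: z12.
Qed.

Lemma le0_geometric (R : realType) (x c : R) :
  (forall k, x <= c / 2 ^+ k) -> x <= 0.
Proof.
move=> xc.
have cg : geometric c (2^-1 : R) k @[k --> \oo] --> 0.
  by apply: cvg_geometric; rewrite ger0_norm ?invr_ge0// invf_lt1// ltr1n.
rewrite -(cvg_lim (@Rhausdorff R) cg).
apply: limr_ge; first by apply/cvg_ex; exists 0.
by apply: nearW => k /=; rewrite exprVn; exact: xc.
Qed.

Lemma geometric_small (R : realType) (c e : R) :
  0 < e -> exists k, c / 2 ^+ k < e.
Proof.
move=> e0; apply: contrapT => /forallNP h.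
suff : e <= 0 by rewrite leNgt e0.
by apply: (@le0_geometric _ _ c) => k; rewrite leNgt; apply/negP; exact: h.
Qed.

(** Uniqueness: [w] and [0] are both fixed points of the Picard operator, so the
    contraction can be iterated on the distance between them, which is bounded
    on the compact interval by its maximum. *)
Lemma linear_ode_zero (R : realType) (n k : nat) (A : R -> 'M[R]_n)
    (w : R -> 'M[R]_(n, k)) (t0 : R) :
  continuous A -> linear_ode_solution A w -> w t0 = 0 -> forall t, w t = 0.
Proof.
move=> cA dw w0 t.
have [K K0 AK] := @mulmx_bound R n k A t0 `|t - t0| cA (normr_ge0 _).
have [||c _ cmax] := @EVT_max R (fun s => `|w s|)
    (t0 - `|t - t0|) (t0 + `|t - t0|).
- by have := normr_ge0 (t - t0); lra.
- apply: continuous_subspaceT => s.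
  apply: continuous_comp; last exact: norm_continuous.
  exact: is_derive_continuous dw s.
have wle i s : `|s - t0| <= `|t - t0| ->
    `|w s - 0| <= `|w c| / 2 ^+ i * expR (2 * K * `|s - t0|).
  elim: i s => [|i IH] s st.
    rewrite expr0 divr1 subr0 (le_trans (cmax s _))//.
      by rewrite in_itv/= -ler_distl.
    by rewrite ler_peMr// -expR0 ler_expR !mulr_ge0.
  rewrite exprSr invfM mulrA.
  apply: (picard_contraction (A := A) (z1 := w) (z2 := cst 0) (v1 := w)
    (v2 := cst 0) (T := `|t - t0|)) => //.
  - by move=> u; rewrite mulmx0; apply: is_derive_cst.
apply/eqP; rewrite -normr_le0.
apply: (@le0_geometric _ _ (`|w c| * expR (2 * K * `|t - t0|))) => i.
by rewrite mulrAC -[w t]subr0; exact: wle.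
Qed.

Lemma geometric_cvg (R : realType) (V : completeNormedModType R) (u : nat -> V)
    (D : R) :
  (forall k, `|u k.+1 - u k| <= D / 2 ^+ k) ->
  cvgn u /\ forall k, `|limn u - u k| <= 2 * D / 2 ^+ k.
Proof.
move=> uD.
have D0 : 0 <= D by have := uD 0%N; rewrite expr0 divr1; apply: le_trans.
have ukj j k : `|u (k + j)%N - u k| <= 2 * D / 2 ^+ k.
  elim: j k => [|j IH] k.
    by rewrite addn0 subrr normr0 divr_ge0 ?mulr_ge0 ?exprn_ge0.
  rewrite -(subrKA (u k.+1)) (le_trans (ler_normD _ _))//.
  rewrite addnS -addSn (le_trans (lerD (IH _) (uD k)))//.
  rewrite exprS le_eqVlt; apply/predU1P; left.
  by field; rewrite expf_neq0.
have cu : cvgn u.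
  apply: cauchy_cvg; apply: cauchy_exP => e /(geometric_small (2 * D))[k ke].
  exists (u k); exists k => // n /= kn.
  by rewrite -ball_normE/= distrC -(subnKC kn) (le_lt_trans (ukj _ _)).
split=> // k.
have ck : `|u n - u k| @[n --> \oo] --> `|limn u - u k|.
  by apply: cvg_norm; apply: cvgB => //; exact: cvg_cst.
rewrite -(cvg_lim (@Rhausdorff R) ck); apply: limr_le.
  by apply/cvg_ex; eexists; exact: ck.
by exists k => // n /= kn; rewrite -(subnKC kn).
Qed.

(* The join of the complete and normed structures on matrices, in which the
   Picard iterates converge by [geometric_cvg]. *)
HB.instance Definition _ (R : realType) m n := Complete.on 'M[R]_(m, n).

(** The Picard iterates [u i] converge on each interval [`[t0 - T, t0 + T]] at a
    geometric rate that is uniform there, so the limit [y] is continuous and one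
    more Picard step [P y] makes sense.  As the step is a contraction, [P y] is
    also the limit of the [u i.+1], hence [P y = y], and [y] inherits the
    derivative of [P y]. *)
Lemma linear_ode_exists (R : realType) (n k : nat) (A : R -> 'M[R]_n)
    (t0 : R) (y0 : 'M[R]_(n, k)) : continuous A ->
  exists y : R -> 'M[R]_(n, k), linear_ode_solution A y /\ y t0 = y0.
Proof.
move=> cA.
(* [P] is the Picard operator, its integral being any primitive null at [t0];
   its values outside the continuous functions are arbitrary. *)
have /choice[P PE] (z : R -> 'M[R]_(n, k)) : exists v : R -> 'M[R]_(n, k),
    continuous z ->
    v t0 = y0 /\ forall t, is_derive t (1 : R) v (A t *m z t).
  have [cz|] := pselect (continuous z); last by exists (cst 0).
  have [|F [F0 dF]] := @exists_primitive_mx R n k (fun t => A t *m z t) t0.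
    by move=> t; apply: continuous_mulmx; [exact: cA|exact: cz].
  exists (F + cst y0) => _; split; first by rewrite !fctE/= F0 add0r.
  move=> t; rewrite -[A t *m z t]addr0.
  exact: is_deriveD.
pose u i := iter i P (cst y0).
have cu i : continuous (u i).
  elim: i => [t|i IH]; first exact: cvg_cst.
  exact: is_derive_continuous (PE _ IH).2.
have u0 i : u i t0 = y0 by case: i => [//|i]; exact: (PE _ (cu i)).1.
have du i t : is_derive t (1 : R) (u i.+1) (A t *m u i t).
  exact: (PE _ (cu i)).2.
have key T : 0 <= T -> exists K D, [/\ 0 <= K,
    forall s, `|s - t0| <= T ->
      forall v : 'M[R]_(n, k), `|A s *m v| <= K * `|v| &
    forall s, `|s - t0| <= T -> forall i, `|u i.+1 s - u i s| <= D / 2 ^+ i].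
  move=> T0; have [K K0 AK] := @mulmx_bound R n k A t0 T cA T0.
  have [||c _ cmax] := @EVT_max R (fun s => `|u 1%N s - u 0%N s|)
    (t0 - T) (t0 + T).
  - lra.
  - apply: continuous_subspaceT => s.
    apply: continuous_comp; last exact: norm_continuous.
    by apply: continuousB; exact: cu.
  set C := `|_ - _| in cmax; have C0 : 0 <= C by rewrite /C.
  (* The weight is at most [expR (2 * K * T)] there and is absorbed in [D]. *)
  exists K, (C * expR (2 * K * T)); split => // s sT i.
  have : `|u i.+1 s - u i s| <= C / 2 ^+ i * expR (2 * K * `|s - t0|).
    elim: i s sT => [|i IH] s sT.
      rewrite expr0 divr1 (le_trans (cmax s _))//.
        by rewrite in_itv/= -ler_distl.
      by rewrite ler_peMr// -expR0 ler_expR !mulr_ge0.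
    rewrite exprSr invfM mulrA.
    have ui : u i.+2 t0 = u i.+1 t0 by rewrite !u0.
    apply: (picard_contraction (A := A) (z1 := u i.+1) (z2 := u i)
      (T := T)) => //.
    by rewrite divr_ge0// exprn_ge0.
  move/le_trans; apply; rewrite [leRHS]mulrAC ler_wpM2l//.
    by rewrite divr_ge0// exprn_ge0.
  by rewrite ler_expR ler_wpM2l// mulr_ge0.
pose y s := limn (u^~ s).
have yu T : 0 <= T -> exists D, forall s, `|s - t0| <= T ->
    forall i, `|y s - u i s| <= D / 2 ^+ i.
  move=> /key[K [D [_ _ uD]]]; exists (2 * D) => s sT i.
  by have [_] := geometric_cvg (uD s sT); apply.
have cy : continuous y.
  move=> s; apply/cvgrPdist_le => e e0.
  have [|D yD] := yu (`|s - t0| + 1); first by rewrite addr_ge0.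
  have [i ie] := @geometric_small R D (e / 3) (divr_gt0 e0 (ltr0n R 3)).
  near=> r.
  have rT : `|r - t0| <= `|s - t0| + 1.
    rewrite -(subrKA s) addrC (le_trans (ler_normD _ _))// lerD2l distrC.
    by near: r; have /cvgrPdist_le := @cvg_id _ (nbhs s); apply.
  have h1 := yD s _ i; have h2 := yD r rT i.
  rewrite -(subrKA (u i s)) (le_trans (ler_normD _ _))//.
  rewrite -(subrKA (u i r) (u i s)).
  rewrite (_ : e = e / 3 + (e / 3 + e / 3)); last by field.
  rewrite lerD//; first by rewrite (le_trans (h1 _))// ?lerDl// ltW.
  rewrite (le_trans (ler_normD _ _))// lerD//; last first.
    by rewrite distrC (le_trans h2)// ltW.
  near: r; have /cvgrPdist_le := cu i s; apply; exact: divr_gt0.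
exists y.
have [Py0 dPy] := PE _ cy.
suff yP : P y = y by rewrite yP in Py0 dPy.
apply/funext => s; apply/eqP; rewrite -subr_eq0 -normr_le0.
have [K [D [K0 AK uD]]] := key `|s - t0| (normr_ge0 _).
have yuD r : `|r - t0| <= `|s - t0| ->
    forall i, `|y r - u i r| <= 2 * D / 2 ^+ i.
  by move=> rs; have [_] := geometric_cvg (uD r rs); apply.
have D0 : 0 <= D.
  by have := uD s (lexx _) 0%N; rewrite expr0 divr1; apply: le_trans.
apply: (@le0_geometric _ _ (D * expR (2 * K * `|s - t0|) + D)) => i.
have a0 : 0 <= 2 * D / 2 ^+ i by rewrite divr_ge0 ?mulr_ge0 ?exprn_ge0.
have Pui : P y t0 = u i.+1 t0 by rewrite u0.
have yu_weighted r : `|r - t0| <= `|s - t0| ->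
    `|y r - u i r| <= 2 * D / 2 ^+ i * expR (2 * K * `|r - t0|).
  move=> rs; rewrite (le_trans (yuD r rs i))// ler_peMr// -expR0 ler_expR.
  by rewrite !mulr_ge0.
have := picard_contraction K0 a0 AK dPy (du i) Pui yu_weighted (lexx _).
have := yuD s (lexx _) i.+1.
rewrite -(subrKA (u i.+1 s)) exprS => h1 h2.
rewrite (le_trans (ler_normD _ _))// mulrDl lerD//.
  rewrite (le_trans h2)// le_eqVlt; apply/predU1P; left.
  by field; rewrite expf_neq0.
rewrite distrC (le_trans h1)// le_eqVlt; apply/predU1P; left.
by field; rewrite expf_neq0.
Unshelve. all: by end_near. Qed.

(** * Smoothness of linear maps *)

Lemma Ck_cst (R : realType) (V W : normedModType R) (k : nat) (c : W) :
  Ck k (cst c : V -> W).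
Proof.
elim: k c => [|k IH] c /=; first by move=> x; exact: cvg_cst.
split=> [x|v]; first exact: differentiable_cst.
rewrite (_ : (fun x => _) = cst 0); first exact: IH.
by apply/funext => x; rewrite derive_cst.
Qed.

Lemma smooth_mulmx (R : realType) (m n k : nat) (A : 'M[R]_(m, n)) :
  smooth (fun x : 'M[R]_(n, k) => A *m x).
Proof.
have cA : continuous (mulmx A : 'M[R]_(n, k) -> 'M[R]_(m, k)).
  move=> x; apply: (@continuous_mulmx _ _ _ _ _ (cst A) id); last exact: cvg_id.
  exact: cst_continuous.
case=> [|j] //=; split=> [x|v].
  exact: (@linear_differentiable _ _ _ (mulmx A)).
rewrite (_ : (fun x => _) = cst (A *m v)); first exact: Ck_cst.
apply/funext => x; rewrite deriveE; last first.
  exact: (@linear_differentiable _ _ _ (mulmx A)).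
by rewrite (@diff_lin _ _ _ (mulmx A)).
Qed.

(** * Invariance of the two families of subspaces *)

Lemma mulmx_cV_inj (R : pzRingType) (m n : nat) (A B : 'M[R]_(m, n)) :
  (forall v : 'cV[R]_n, A *m v = B *m v) -> A = B.
Proof.
move=> AB; apply/matrixP => i j.
by have := AB (delta_mx j 0); rewrite -!colE => /colP/(_ i); rewrite !mxE.
Qed.

Lemma linear_ode_solution_mulr (R : realType) (m n p : nat) (A : R -> 'M[R]_m)
    (Y : R -> 'M[R]_(m, n)) (C : 'M[R]_(n, p)) :
  linear_ode_solution A Y -> linear_ode_solution A (fun t => Y t *m C).
Proof.
move=> dY t; have := is_derive_mulmx (dY t) (is_derive_cst C t 1).
by rewrite mulmx0 addr0 -mulmxA.
Qed.

Section projection_field.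
Context {R : realType} {m : nat}.
Variables (M Q : R -> 'M[R]_m).
Hypotheses (cQ : continuous Q) (dM : forall t, derivable M t (1 : R)).

Let dME t : is_derive t (1 : R) M (derive1 M t).
Proof. exact: is_derive_derive1. Qed.

(** Follow the solution [y] issuing from [v]: differentiating [y = M y] and
    using the equation for [y] gives [Q y = M' y + M Q y], and [Q M y = Q y]. *)
Lemma fix_space_invariant_Lop0 (t : R) (v : 'cV[R]_m) :
  invariant_manifold Q (fix_space M) -> fix_space M t v -> Lop M Q t *m v = 0.
Proof.
move=> inv Mv; have [y [dy yt]] := linear_ode_exists t v cQ.
have yM : y = fun s => M s *m y s.
  by apply/funext => s; apply: (inv _ dy t); rewrite yt.
have := is_derive_mulmx (dME t) (dy t).
rewrite -yM => /(is_derive_unique (dy t)); rewrite yt => Qv.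
by rewrite /Lop mulmxBl mulmxDl -!mulmxA -Qv -[M t *m v]Mv subrr.
Qed.

(** As for the fixed space, now differentiating [M y = 0]. *)
Lemma null_space_invariant_Lop0 (t : R) (v : 'cV[R]_m) :
  invariant_manifold Q (null_space M) -> null_space M t v -> Lop M Q t *m v = 0.
Proof.
move=> inv Mv; have [y [dy yt]] := linear_ode_exists t v cQ.
have yM : (fun s => M s *m y s) = cst 0.
  by apply/funext => s; apply: (inv _ dy t); rewrite yt.
have := is_derive_mulmx (dME t) (dy t).
rewrite yM => /(is_derive_unique (is_derive_cst _ _ _)); rewrite yt => Qv.
by rewrite /Lop mulmxBl mulmxDl -!mulmxA -Qv [M t *m v]Mv mulmx0 subrr.
Qed.

(** The defect [w = y - M y] of a solution satisfies [w' = Q w - L y], and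
    [L y = L w] because [L M = 0].  So [w] solves a linear equation, and it
    vanishes everywhere once it vanishes somewhere. *)
Lemma Lop_mul_fix_space_invariant : continuous (Lop M Q) ->
  (forall t, Lop M Q t *m M t = 0) -> invariant_manifold Q (fix_space M).
Proof.
move=> cL LM y dy t0 yt0 t.
pose w s := y s - M s *m y s.
have : linear_ode_solution (fun s => Q s - Lop M Q s) w.
  move=> s.
  have -> : (Q s - Lop M Q s) *m w s =
      Q s *m y s - (derive1 M s *m y s + M s *m (Q s *m y s)).
    have LMy : Lop M Q s *m (M s *m y s) = 0 by rewrite mulmxA LM mul0mx.
    rewrite /w mulmxBr [X in _ - X]mulmxBl LMy subr0 mulmxBl.
    rewrite /Lop mulmxBl mulmxDl -!mulmxA.
    by rewrite opprB addrA addrAC addrK.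
  by apply: is_deriveB; [exact: dy|exact: is_derive_mulmx].
move/linear_ode_zero => /(_ t0) w0; apply/eqP; rewrite -subr_eq0; apply/eqP.
apply: w0; last by rewrite /w -yt0 subrr.
by move=> s; apply: continuousB; [exact: cQ|exact: cL].
Qed.

(** [L = 0] says that [M] maps solutions to solutions; a solution [M y] that
    vanishes somewhere is null. *)
Lemma Lop0_null_space_invariant :
  (forall t, Lop M Q t = 0) -> invariant_manifold Q (null_space M).
Proof.
move=> L0 y dy t0 yt0 t.
apply: (@linear_ode_zero R m 1 Q (fun s => M s *m y s) t0) => // s.
have -> : Q s *m (M s *m y s) = derive1 M s *m y s + M s *m (Q s *m y s).
  have /eqP := L0 s; rewrite /Lop subr_eq0 => /eqP e.
  by rewrite !mulmxA -e mulmxDl.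
exact: is_derive_mulmx.
Qed.

End projection_field.

(** * The equation on the fixed space *)

Section reduction.
Context {R : realType} {m n : nat}.
Variables (Q : R -> 'M[R]_m) (Phi : R -> 'M[R]_(n, m))
  (Phip : R -> 'M[R]_(m, n)).
Hypotheses (cQ : continuous Q) (dPhi : continuously_differentiable Phi)
  (dPhip : continuously_differentiable Phip)
  (PhiK : forall t, Phi t *m Phip t = 1%:M).

Let M t := Phip t *m Phi t.

Let is_dPhi t : is_derive t (1 : R) Phi (derive1 Phi t).
Proof. exact/is_derive_derive1/dPhi.1. Qed.

Let is_dPhip t : is_derive t (1 : R) Phip (derive1 Phip t).
Proof. exact/is_derive_derive1/dPhip.1. Qed.

Let is_dM t : is_derive t (1 : R) M
  (derive1 Phip t *m Phi t + Phip t *m derive1 Phi t).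
Proof. exact: is_derive_mulmx. Qed.

Lemma proj_idem t : M t *m M t = M t.
Proof. by rewrite /M mulmxA -(mulmxA (Phip t)) PhiK mulmx1. Qed.

Lemma derivable_proj t : derivable M t (1 : R).
Proof. by case: (is_dM t). Qed.

Lemma continuous_Lop_proj : continuous (Lop M Q).
Proof.
have cPhi := is_derive_continuous is_dPhi.
have cPhip := is_derive_continuous is_dPhip.
have cM := is_derive_continuous is_dM.
have -> : Lop M Q = fun s => derive1 Phip s *m Phi s + Phip s *m derive1 Phi s +
    M s *m Q s - Q s *m M s.
  apply/funext => s; rewrite /Lop; congr (_ + _ - _).
  apply: (is_derive_unique _ (is_dM s)).
  exact/is_derive_derive1/derivable_proj.
move=> t; apply: cvgB; last first.
  by apply: continuous_mulmx; [exact: cQ|exact: cM].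
apply: cvgD; last by apply: continuous_mulmx; [exact: cM|exact: cQ].
by apply: cvgD; apply: continuous_mulmx;
  [exact: dPhip.2|exact: cPhi|exact: cPhip|exact: dPhi.2].
Qed.

(** The inverse is the restriction of the linear map [Phi t], since
    [Phi t *m Phip t = 1] and [Phip t *m Phi t] is the identity on its fixed
    space. *)
Lemma proj_diffeomorphism t :
  diffeomorphism_onto (fix_space M t) (fun x : 'cV[R]_n => Phip t *m x).
Proof.
split; first exact: smooth_mulmx.
- split.
  + move=> x _; rewrite /fix_space/= mulmxA /M -(mulmxA (Phip t)).
    by rewrite PhiK mulmx1.
  + move=> x x' _ _ e.
    by rewrite -[x]mul1mx -[x']mul1mx -(PhiK t) -!mulmxA e.
  + by move=> y /= My; exists (Phi t *m y) => //; rewrite mulmxA [RHS]My.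
- exists (mulmx (Phi t)); split; first exact: smooth_mulmx.
  by move=> x; rewrite mulmxA PhiK mul1mx.
Qed.

(** The columns of [Phip 0] lie in the fixed space at time [0], so invariance
    gives [M Y Phip(0) = Y Phip(0)].  This is what makes [Phi Y Phip(0)] satisfy
    the reduced equation: its derivative is [(Phi' + Phi Q) Y Phip(0)], where
    [Phip Phi] can be inserted before [Y].  Uniqueness identifies it with [X],
    and multiplying by [Phip] yields the other formula. *)
Lemma reduced_fundamental_matrix (Y : R -> 'M[R]_m) (X : R -> 'M[R]_n) :
  invariant_manifold Q (fix_space M) ->
  fundamental_matrix Q Y ->
  fundamental_matrix (fun t => (derive1 Phi t + Phi t *m Q t) *m Phip t) X ->
  forall t, Y t *m Phip 0 = Phip t *m X t /\ X t = Phi t *m Y t *m Phip 0.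
Proof.
move=> inv [dY Y0] [dX X0].
have dYP := linear_ode_solution_mulr (Phip 0) dY.
have MY t : M t *m (Y t *m Phip 0) = Y t *m Phip 0.
  apply: mulmx_cV_inj => v; apply/esym; rewrite -[RHS]mulmxA.
  apply: (inv (fun s => Y s *m Phip 0 *m v) _ 0).
    exact: linear_ode_solution_mulr.
  by rewrite /fix_space/= Y0 mul1mx /M -mulmxA [Phi 0 *m _]mulmxA PhiK mul1mx.
have XE t : X t = Phi t *m (Y t *m Phip 0).
  apply/eqP; rewrite -subr_eq0; apply/eqP.
  pose P s := (derive1 Phi s + Phi s *m Q s) *m Phip s.
  apply: (@linear_ode_zero R n n P (fun s => X s - Phi s *m (Y s *m Phip 0)) 0).
  - move=> s.
    have cPhi := is_derive_continuous is_dPhi.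
    have cPhip := is_derive_continuous is_dPhip.
    apply: (@continuous_mulmx _ _ _ _ _
      (fun u => derive1 Phi u + Phi u *m Q u)); last exact: cPhip.
    apply: cvgD; first exact: dPhi.2.
    by apply: continuous_mulmx; [exact: cPhi|exact: cQ].
  - move=> s; rewrite mulmxBr.
    have -> : P s *m (Phi s *m (Y s *m Phip 0)) =
        derive1 Phi s *m (Y s *m Phip 0) + Phi s *m (Q s *m (Y s *m Phip 0)).
      by rewrite /P -mulmxA [Phip s *m _]mulmxA -/(M s) MY mulmxDl !mulmxA.
    by apply: is_deriveB; [exact: dX|exact: is_derive_mulmx].
  - by rewrite X0 Y0 mul1mx PhiK subrr.
by move=> t; rewrite -mulmxA -XE; split=> //; rewrite XE mulmxA -/(M t) MY.
Qed.

End reduction.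

Unset Implicit Arguments.

Theorem theorem1 (R : realType) (m n : nat) (hn : (1 <= n)%N) (hnm : (n < m)%N)
    (Q : R -> 'M[R]_m) (Phi : R -> 'M[R]_(n, m)) (Phip : R -> 'M[R]_(m, n))
    (hQ : continuous Q)
    (hPhi : continuously_differentiable Phi)
    (hPhip : continuously_differentiable Phip)
    (hrank : forall t : R, \rank (Phi t) = n)
    (hpinv : forall t : R, Phi t *m Phip t = 1%:M) :
  let M := fun t : R => Phip t *m Phi t in
  let Mn := fix_space M in
  let Mmn := null_space M in
  let L := Lop M Q in
  let P := fun t : R => (derive1 Phi t + Phi t *m Q t) *m Phip t in
  [/\ (invariant_manifold Q Mn /\ invariant_manifold Q Mmn) <->
        (forall t : R, L t = 0),
      (invariant_manifold Q Mn <-> (forall t : R, L t *m M t = 0)) /\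
      (invariant_manifold Q Mn ->
        (forall t : R,
          diffeomorphism_onto (Mn t) (fun x : 'cV[R]_n => Phip t *m x)) /\
        (forall (Y : R -> 'M[R]_m) (X : R -> 'M[R]_n),
          fundamental_matrix Q Y -> fundamental_matrix P X ->
          forall t : R, Y t *m Phip 0 = Phip t *m X t /\
                        X t = Phi t *m Y t *m Phip 0)) &
      invariant_manifold Q Mmn ->
        forall t : R, Mmn t `<=` null_space L t].
Proof.
move=> M Mn Mmn L P.
have dM : forall t, derivable M t (1 : R) by exact: derivable_proj.
have MM t : M t *m M t = M t by exact: proj_idem.
have cL : continuous L by exact: continuous_Lop_proj.
have fixP : invariant_manifold Q Mn <-> forall t, L t *m M t = 0.
  split=> [inv t|]; last exact: Lop_mul_fix_space_invariant.
  apply: mulmx_cV_inj => v; rewrite mul0mx -mulmxA.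
  by apply: fix_space_invariant_Lop0 => //; rewrite /fix_space /mkset mulmxA MM.
have null0 : invariant_manifold Q Mmn -> forall t, Mmn t `<=` null_space L t.
  by move=> inv t v Mv; exact: null_space_invariant_Lop0.
split=> //; last first.
  split=> // inv; split; first by move=> t; exact: proj_diffeomorphism.
  by move=> Y X; exact: reduced_fundamental_matrix.
split=> [[invn invmn] t|L0]; last first.
  split; last exact: Lop0_null_space_invariant.
  by apply/fixP => t; rewrite L0 mul0mx.
(* [L = L M + L (1 - M)], and [1 - M] takes its values in the null space. *)
rewrite -[L t]mulmx1 -(subrKC (M t) 1%:M) mulmxDr (fixP.1 invn) add0r.
apply: mulmx_cV_inj => v; rewrite mul0mx -mulmxA.
apply: null0 => //; rewrite /Mmn /null_space /mkset mulmxA mulmxBr mulmx1.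
by rewrite MM subrr mul0mx.
Qed.
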